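(* Let $b,\alpha\in\mathbb C$, $\lambda\in\mathbb C^*$, $h(t)\in\mathbb C[t]$, and let $X$ be either of the $\mathscr V$-modules $\Phi(\lambda,\alpha,h)$ or $\Theta(\lambda,h)$. Then each $\mathscr V$-submodule of $X$ is finitely generated if and only if $\deg h(t)\geq1$.
   Context: $\mathscr V$ is the Virasoro algebra: the complex Lie algebra with basis $\{L_m,C\mid m\in\mathbb Z\}$ and brackets $[L_m,L_n]=(n-m)L_{m+n}+\delta_{m+n,0}\frac{m^3-m}{12}C$, $[L_m,C]=0$. For $b\in\mathbb C$, $W(0,b)$ is the complex Lie algebra with basis $\{L_m,W_m\mid m\in\mathbb Z\}$ and brackets $[L_m,L_n]=(n-m)L_{m+n}$, $[L_m,W_n]=(n+bm)W_{m+n}$, $[W_m,W_n]=0$. For $\lambda\in\mathbb C^*$, $\alpha\in\mathbb C$, $h=h(t)\in\mathbb C[t]$, put $g(t)=\frac{h(t)-h(\alpha)}{t-\alpha}\in\mathbb C[t]$ and $h_m(t)=mh(t)-m\alpha\big(\delta_{b,-1}(m-1)+\delta_{b,1}\big)g(t)$ for $m\in\mathbb Z$. The $W(0,b)$-module $\Phi(\lambda,\alpha,h)$ is the polynomial space $\mathbb C[s,t]$ with action $$L_mf(s,t)=\lambda^m\Big(\big(s+h_m(t)\big)f(s-m,t)+bm\big(t-\delta_{b,-1}m\alpha-\delta_{b,1}\alpha\big)\tfrac{\partial}{\partial t}f(s-m,t)\Big),$$ $$W_mf(s,t)=\lambda^m\big(t-\delta_{b,-1}m\alpha-\delta_{b,1}(1-\delta_{m,0})\alpha\big)f(s-m,t).$$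 The $W(0,1)$-module $\Theta(\lambda,h)$ is $\mathbb C[s,t]$ with action $L_mf(s,t)=\lambda^m(s+mh(t))f(s-m,t)$, $W_mf(s,t)=\delta_{m,0}tf(s,t)$. Both are regarded as $\mathscr V$-modules through the action of the $L_m$, with $C$ acting as $0$. The degree of the zero polynomial is regarded as less than $1$ in this statement. *)

(* Defs.v *)
From HB Require Import structures.
From mathcomp Require Import all_boot all_order all_algebra.
From mathcomp Require Import finmap ring reals.
From mathcomp.real_closed Require Import complex.
From mathcomp.multinomials Require Import monalg.

Set Implicit Arguments.
Unset Strict Implicit.
Unset Printing Implicit Defensive.
Import Order.TTheory GRing.Theory Num.Theory.
Local Open Scope ring_scope.

HB.mixin Record Lmodule_isLieAlgebra (K : comNzRingType) L of GRing.Lmodule K L := {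
  bracket : L -> L -> L;
  bracket_linear_l : forall y, linear (bracket^~ y);
  bracket_linear_r : forall x, linear (bracket x);
  bracketxx : forall x, bracket x x = 0;
  jacobi : forall x y z,
    bracket x (bracket y z) + bracket y (bracket z x) + bracket z (bracket x y) = 0
}.

#[short(type="lieAlgType")]
HB.structure Definition LieAlgebra (K : comNzRingType) :=
  { L of GRing.Lmodule K L & Lmodule_isLieAlgebra K L }.

Record lieModule (K : comNzRingType) (L : lieAlgType K) := LieModule {
  lie_carrier :> lmodType K;
  lact : L -> lie_carrier -> lie_carrier;
  lact_linear_l : forall v, linear (lact^~ v);
  lact_linear_r : forall x, linear (lact x);
  lact_bracket : forall x y v,
    lact (bracket x y) v = lact x (lact y v) - lact y (lact x v)
}.

Section Submodules.
Context (K : comNzRingType) (L : lieAlgType K) (M : lieModule L).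

Record lie_submodule (N : M -> Prop) : Prop := LieSubmodule {
  submod0 : N 0;
  submodD : forall u v, N u -> N v -> N (u + v);
  submodZ : forall (a : K) u, N u -> N (a *: u);
  submod_act : forall (x : L) u, N u -> N (lact x u)
}.

(* v lies in the smallest submodule containing S. *)
Definition lie_generated (S : seq M) (v : M) : Prop :=
  forall N : M -> Prop, lie_submodule N -> (forall u, u \in S -> N u) -> N v.

Definition finitely_generated (N : M -> Prop) : Prop :=
  exists S : seq M, forall v, N v <-> lie_generated S v.

End Submodules.

Record lie_hom (K : comNzRingType) (L1 L2 : lieAlgType K) := LieHom {
  lie_fun :> L1 -> L2;
  lie_fun_linear : linear lie_fun;
  lie_fun_bracket : forall x y, lie_fun (bracket x y) = bracket (lie_fun x) (lie_fun y)
}.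

Section Restriction.
Context (K : comNzRingType) (L1 L2 : lieAlgType K).
Context (phi : lie_hom L1 L2) (M : lieModule L2).

Let ract (x : L1) (v : M) : M := lact (phi x) v.

Fact ract_linear_l v : linear (ract^~ v).
Proof. by move=> a x y; rewrite /ract lie_fun_linear lact_linear_l. Qed.

Fact ract_linear_r x : linear (ract x).
Proof. by move=> a u v; rewrite /ract lact_linear_r. Qed.

Fact ract_bracket x y v : ract (bracket x y) v = ract x (ract y v) - ract y (ract x v).
Proof. by rewrite /ract lie_fun_bracket lact_bracket. Qed.

Definition restrict_module : lieModule L1 :=
  LieModule ract_linear_l ract_linear_r ract_bracket.

End Restriction.

(* Linear extension to the space {malg K[I]} freely spanned by I. *)
Section LinearExtension.
Context (K : comNzRingType) (I : choiceType) (V : lmodType K).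

Definition linext (f : I -> V) (x : {malg K[I]}) : V :=
  \sum_(i <- msupp x) x@_i *: f i.

Lemma linextEw f (x : {malg K[I]}) (d : {fset I}) :
  (msupp x `<=` d)%fset -> linext f x = \sum_(i <- d) x@_i *: f i.
Proof.
move=> sub; rewrite /linext (big_fset_incl _ sub) // => i _.
by move=> /mcoeff_outdom ->; rewrite scale0r.
Qed.

Lemma linext_linear f : linear (linext f).
Proof.
move=> a x y; pose d := (msupp x `|` msupp y `|` msupp (a *: x + y))%fset.
rewrite (@linextEw f x d); last first.
  by rewrite /d -fsetUA fsubsetUl.
rewrite (@linextEw f y d); last first.
  by rewrite /d (fsetUC (msupp x)) -fsetUA fsubsetUl.
rewrite (@linextEw f _ d); last by rewrite /d fsubsetUr.
rewrite scaler_sumr -big_split /=; apply: eq_bigr => i _.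
by rewrite mcoeffD mcoeffZ scalerDl scalerA.
Qed.

Lemma linextU f i : linext f << i >> = f i.
Proof.
by rewrite (@linextEw f _ [fset i]%fset) ?msuppU_le // big_seq_fset1 mcoeffUU scale1r.
Qed.

Lemma eq_linext f g : f =1 g -> linext f =1 linext g.
Proof. by move=> fg x; apply: eq_bigr => i _; rewrite fg. Qed.

Lemma linear_malg_eq0 (F : {malg K[I]} -> V) :
  linear F -> (forall i, F << i >> = 0) -> forall x, F x = 0.
Proof.
move=> linF F0 x.
have F00 : F 0 = 0.
  have := linF (-1) 0 0; rewrite scaler0 addr0 => ->.
  by rewrite scaleN1r addNr.
rewrite (monalgE x); elim: (enum_fset _) => [|i s IHs]; first by rewrite big_nil.
rewrite big_cons -[X in << X *g i >>]mulr1.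
have -> : << x@_i * 1 *g i >> = x@_i *: << i >>.
  by apply/malgP => k; rewrite mcoeffZ !mcoeffU mulrnAr.
by rewrite linF F0 IHs scaler0 addr0.
Qed.

End LinearExtension.

(* Lie algebras given by structure constants br on a basis I. *)
Section StructureConstants.
Context (K : numFieldType) (I : choiceType).
Context (br : I -> I -> {malg K[I]}).

Definition basis_bracket (x y : {malg K[I]}) : {malg K[I]} :=
  linext (fun i => linext (br i) y) x.

Lemma basis_bracketUU i j : basis_bracket << i >> << j >> = br i j.
Proof. by rewrite /basis_bracket !linextU. Qed.

Lemma basis_bracket_linear_l y : linear (basis_bracket^~ y).
Proof. exact: linext_linear. Qed.

Lemma basis_bracket_linear_r x : linear (basis_bracket x).
Proof.
move=> a u v; rewrite /basis_bracket /linext scaler_sumr -big_split /=.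
apply: eq_bigr => i _; rewrite -!/(linext _ _) linext_linear scalerDr !scalerA.
by rewrite mulrC.
Qed.

Context (brC : forall i j, br i j = - br j i).

Lemma basis_bracketC x y : basis_bracket x y = - basis_bracket y x.
Proof.
apply/eqP; rewrite -subr_eq0 opprK; apply/eqP; move: x.
apply: (@linear_malg_eq0 _ _ _ (fun x => basis_bracket x y + basis_bracket y x)).
  move=> a u v; rewrite basis_bracket_linear_l basis_bracket_linear_r scalerDr.
  by rewrite addrACA.
move=> i; move: y.
apply: (@linear_malg_eq0 _ _ _
  (fun y => basis_bracket << i >> y + basis_bracket y << i >>)).
  move=> a u v; rewrite basis_bracket_linear_l basis_bracket_linear_r scalerDr.
  by rewrite addrACA.
by move=> j; rewrite !basis_bracketUU brC addNr.
Qed.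

Lemma basis_bracketxx x : basis_bracket x x = 0.
Proof.
have /eqP := basis_bracketC x x.
rewrite -addr_eq0 -mulr2n -scaler_nat scaler_eq0 pnatr_eq0 /=.
by move/eqP.
Qed.

Context (br_jacobi : forall i j k,
  linext (br i) (br j k) + linext (br j) (br k i) + linext (br k) (br i j) = 0).

Lemma basis_jacobi x y z :
  basis_bracket x (basis_bracket y z) + basis_bracket y (basis_bracket z x)
    + basis_bracket z (basis_bracket x y) = 0.
Proof.
have ll := basis_bracket_linear_l; have lr := basis_bracket_linear_r.
pose J x y z := basis_bracket x (basis_bracket y z)
  + basis_bracket y (basis_bracket z x) + basis_bracket z (basis_bracket x y).
have linJ u v : linear (fun w => J w u v).
  move=> a w w'; rewrite /J !ll !lr !scalerDr.
  by rewrite [LHS](AC ((2*2)*2) ((1*3*5)*(2*4*6))).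
have rotJ u v w : J u v w = J v w u.
  by rewrite /J [RHS](AC 3 (3*1*2)).
rewrite -/(J x y z); move: x; apply: (@linear_malg_eq0 _ _ _ (fun x => J x y z)) => // i.
rewrite rotJ; move: y.
apply: (@linear_malg_eq0 _ _ _ (fun y => J y z << i >>)) => // j.
rewrite rotJ; move: z.
apply: (@linear_malg_eq0 _ _ _ (fun z => J z << i >> << j >>)) => // k.
by rewrite /J !basis_bracketUU /basis_bracket !linextU.
Qed.

(* A module is determined by the operators of the basis elements. *)
Section BasisAction.
Context (V : lmodType K) (op : I -> V -> V).

Definition basis_act (x : {malg K[I]}) (v : V) : V := linext (op^~ v) x.

Lemma basis_actU i v : basis_act << i >> v = op i v.
Proof. exact: linextU. Qed.

Lemma basis_act_linear_l v : linear (basis_act^~ v).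
Proof. exact: linext_linear. Qed.

Context (op_linear : forall i, linear (op i)).

Lemma basis_act_linear_r x : linear (basis_act x).
Proof.
move=> a u v; rewrite /basis_act /linext scaler_sumr -big_split /=.
by apply: eq_bigr => i _; rewrite op_linear scalerDr !scalerA mulrC.
Qed.

Context (op_bracket : forall i j v,
  basis_act (br i j) v = op i (op j v) - op j (op i v)).

Lemma basis_act_bracket x y v : basis_act (basis_bracket x y) v
  = basis_act x (basis_act y v) - basis_act y (basis_act x v).
Proof.
have ll := basis_act_linear_l; have lr := basis_act_linear_r.
apply/eqP; rewrite -subr_eq0; apply/eqP; move: x.
pose D x y := basis_act (basis_bracket x y) v
  - (basis_act x (basis_act y v) - basis_act y (basis_act x v)).
apply: (@linear_malg_eq0 _ _ _ (fun x => D x y)).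
  move=> a u w; rewrite /D basis_bracket_linear_l !ll lr.
  rewrite !(scalerDr, scalerN, opprD, opprK).
  by rewrite [LHS](AC (2*(2*2)) ((1*(3*5))*(2*(4*6)))).
move=> i; move: y; apply: (@linear_malg_eq0 _ _ _ (fun y => D << i >> y)).
  move=> a u w; rewrite /D basis_bracket_linear_r !ll lr.
  rewrite !(scalerDr, scalerN, opprD, opprK).
  by rewrite [LHS](AC (2*(2*2)) ((1*(3*5))*(2*(4*6)))).
by move=> j; rewrite /D basis_bracketUU !basis_actU op_bracket subrr.
Qed.

End BasisAction.

End StructureConstants.

Section Virasoro.
Context (K : numFieldType).

(* Basis: L_m is Some m and the central element C is None. *)
Definition virL (m : int) : {malg K[option int]} := << Some m >>.
Definition virC : {malg K[option int]} := << None >>.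

Definition vir_br (i j : option int) : {malg K[option int]} :=
  match i, j with
  | Some m, Some n =>
      (n - m)%:~R *: virL (m + n)
        + ((m + n == 0)%:R * ((m ^+ 3 - m)%:~R / 12)) *: virC
  | _, _ => 0
  end.

Let comb2 (x x' y y' : K) (u v : {malg K[option int]}) :
  x = x' -> y = y' -> x *: u + y *: v = x' *: u + y' *: v.
Proof. by move=> -> ->. Qed.

Fact vir_brC i j : vir_br i j = - vir_br j i.
Proof.
case: i j => [m|] [n|]; rewrite ?oppr0 //= opprD -!scaleNr (addrC n m).
apply: comb2; first by rewrite -rmorphN opprB.
have [mn0|_] := eqVneq (m + n) 0; last by rewrite !mul0r oppr0.
have -> : n = - m by apply/eqP; rewrite -addr_eq0 addrC mn0.
rewrite /= !mul1r -mulNr -rmorphN; congr (_%:~R / _); ring.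
Qed.

Fact linext_vir_br i a b k : linext (vir_br i) (a *: virL k + b *: virC)
  = a *: vir_br i (Some k).
Proof.
rewrite linext_linear /virL linextU.
rewrite -[b *: virC]addr0 linext_linear /virC linextU.
have -> : linext (vir_br i) 0 = 0 by rewrite /linext msupp0 big_seq_fset0.
by case: i => [m|] /=; rewrite !scaler0 !addr0.
Qed.

Fact vir_jacobi i j k : linext (vir_br i) (vir_br j k)
  + linext (vir_br j) (vir_br k i) + linext (vir_br k) (vir_br i j) = 0.
Proof.
have l0 u : linext (vir_br u) 0 = 0 by rewrite /linext msupp0 big_seq_fset0.
have lN v : linext (vir_br None) v = 0.
  by rewrite /linext big1 // => ? _; rewrite scaler0.
case: i => [m|]; last by case: j => [n|]; case: k => [p|]; rewrite /= !(l0, lN, add0r).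
case: j => [n|]; last by case: k => [p|]; rewrite /= !(l0, lN, add0r).
case: k => [p|]; last by rewrite /= !(l0, lN, add0r).
rewrite [vir_br (Some n) _]/= [vir_br (Some p) (Some m)]/=.
rewrite [vir_br (Some m) (Some n)]/= !linext_vir_br /=.
have -> : n + (p + m) = m + (n + p) by ring.
have -> : p + (m + n) = m + (n + p) by ring.
rewrite !scalerDr !scalerA [LHS](AC (2*2*2) ((1*3*5)*(2*4*6))) /= -!scalerDl.
transitivity (0 *: virL (m + (n + p)) + 0 *: virC); last by rewrite !scale0r addr0.
apply: comb2; first by ring.
have [mnp0|_] := eqVneq (m + (n + p)) 0; last by rewrite !mul0r !mulr0 !addr0.
have -> : p = - m - n.
  by apply/eqP; rewrite -subr_eq0 -[X in _ == X]mnp0; apply/eqP; ring.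
rewrite /= !mul1r !mulrA -!rmorphM -!mulrDl -!rmorphD /=.
set x := (X in X%:~R); have -> : x = 0 by rewrite /x; ring.
by rewrite mul0r.
Qed.

Definition vir := {malg K[option int]}.
HB.instance Definition _ := GRing.Lmodule.on vir.
HB.instance Definition _ := Lmodule_isLieAlgebra.Build K vir
  (basis_bracket_linear_l vir_br) (basis_bracket_linear_r vir_br)
  (basis_bracketxx vir_brC) (basis_jacobi vir_jacobi).

End Virasoro.

(* The vector space does not depend on b, the bracket declared on it does. *)
Definition w0 (K : numFieldType) (b : K) := {malg K[(int + int)%type]}.
HB.instance Definition _ (K : numFieldType) (b : K) := GRing.Lmodule.on (w0 b).

Section W0.
Context (K : numFieldType) (b : K).

(* Basis: L_m is inl m and W_m is inr m. *)
Definition w0L (m : int) : {malg K[(int + int)%type]} := << inl m >>.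
Definition w0W (m : int) : {malg K[(int + int)%type]} := << inr m >>.

Definition w0_br (i j : int + int) : {malg K[(int + int)%type]} :=
  match i, j with
  | inl m, inl n => (n - m)%:~R *: w0L (m + n)
  | inl m, inr n => (n%:~R + b * m%:~R) *: w0W (m + n)
  | inr m, inl n => - (m%:~R + b * n%:~R) *: w0W (m + n)
  | inr _, inr _ => 0
  end.

Fact w0_brC i j : w0_br i j = - w0_br j i.
Proof.
case: i j => [m|m] [n|n]; rewrite /=.
- by rewrite (addrC n m) -scaleNr -rmorphN opprB.
- by rewrite scaleNr opprK (addrC n m).
- by rewrite scaleNr (addrC n m).
- by rewrite oppr0.
Qed.

Fact linext_w0Z i a k : linext (w0_br i) (a *: << k >>) = a *: w0_br i k.
Proof.
rewrite -[a *: _]addr0 linext_linear linextU.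
have -> : linext (w0_br i) 0 = 0 by rewrite /linext msupp0 big_seq_fset0.
by rewrite addr0.
Qed.

Fact w0_jacobi i j k : linext (w0_br i) (w0_br j k)
  + linext (w0_br j) (w0_br k i) + linext (w0_br k) (w0_br i j) = 0.
Proof.
(* Abstract variables keep rewriting from unfolding linext and 0. *)
have [F [nul [FE ez FZ F0]]] : exists F nul,
  [/\ (fun i => linext (w0_br i)) = F, nul = 0,
    forall i a k, F i (a *: << k >>) = a *: w0_br i k & forall i, F i nul = 0].
  exists (fun i => linext (w0_br i)), 0; split=> // [i' a k'|i'].
    exact: linext_w0Z.
  by rewrite /linext msupp0 big_seq_fset0.
rewrite -![linext (w0_br _)]/((fun i => linext (w0_br i)) _) FE.
have bLL m n : w0_br (inl m) (inl n) = (n - m)%:~R *: << inl (m + n) >> by [].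
have bLW m n : w0_br (inl m) (inr n) = (n%:~R + b * m%:~R) *: << inr (m + n) >>.
  by [].
have bWL m n : w0_br (inr m) (inl n) = - (m%:~R + b * n%:~R) *: << inr (m + n) >>.
  by [].
have bWW m n : w0_br (inr m) (inr n) = nul by rewrite ez.
have e1 (m n p : int) : n + (p + m) = m + (n + p) by ring.
have e2 (m n p : int) : p + (m + n) = m + (n + p) by ring.
have z3 (x y z : K) (v : {malg K[(int + int)%type]}) :
  x + y + z = 0 -> x *: v + y *: v + z *: v = 0.
  by move=> xyz0; rewrite -!scalerDl xyz0 scale0r.
case: i j k => [m|m] [n|n] [p|p];
  rewrite !(bLL, bLW, bWL, bWW) ?F0 ?FZ ?(bLL, bLW, bWL, bWW) ?ez ?scaler0 ?addr0 //.
all: rewrite !scalerA (e1 m n p) (e2 m n p); apply: z3; ring.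
Qed.

HB.instance Definition _ := Lmodule_isLieAlgebra.Build K (w0 b)
  (basis_bracket_linear_l w0_br) (basis_bracket_linear_r w0_br)
  (basis_bracketxx w0_brC) (basis_jacobi w0_jacobi).

(* The homomorphism L_m |-> L_m, C |-> 0. *)
Definition vir_to_w0_fun : vir K -> w0 b :=
  linext (fun i : option int => if i is Some m then w0L m else 0).

Fact vir_to_w0_linear : linear vir_to_w0_fun.
Proof. exact: linext_linear. Qed.

Fact vir_to_w0_bracket x y :
  vir_to_w0_fun (bracket x y) = bracket (vir_to_w0_fun x) (vir_to_w0_fun y).
Proof.
have lin := vir_to_w0_linear.
apply/eqP; rewrite -subr_eq0; apply/eqP; move: x.
apply: (@linear_malg_eq0 _ _ _ (fun x : vir K =>
  vir_to_w0_fun (bracket x y) - bracket (vir_to_w0_fun x) (vir_to_w0_fun y))).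
  move=> a u w; rewrite bracket_linear_l !lin bracket_linear_l.
  by rewrite scalerBr opprD addrACA.
move=> i; pose e : vir K := << i >>; rewrite -/e; move: y.
apply: (@linear_malg_eq0 _ _ _ (fun y : vir K =>
  vir_to_w0_fun (bracket e y) - bracket (vir_to_w0_fun e) (vir_to_w0_fun y))).
  move=> a u w; rewrite bracket_linear_r !lin bracket_linear_r.
  by rewrite scalerBr opprD addrACA.
move=> j; apply/eqP; rewrite subr_eq0; apply/eqP.
have fU k : vir_to_w0_fun << k >> = if k is Some m then w0L m else 0 by exact: linextU.
have f0 : vir_to_w0_fun 0 = 0 by rewrite /vir_to_w0_fun /linext msupp0 big_seq_fset0.
rewrite /e [X in vir_to_w0_fun X = _]basis_bracketUU !fU {e}.
case: i j => [m|] [n|] /=.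
- rewrite [RHS]basis_bracketUU /= lin fU.
  by rewrite -[_ *: virC K]addr0 lin fU f0 scaler0 !addr0.
- by rewrite f0 [RHS]/bracket /= /basis_bracket linextU /linext msupp0 big_seq_fset0.
- by rewrite f0 [RHS]/bracket /= /basis_bracket /linext msupp0 big_seq_fset0.
- by rewrite f0 [RHS]/bracket /= /basis_bracket /linext msupp0 big_seq_fset0.
Qed.

Definition vir_to_w0 : lie_hom (vir K) (w0 b) :=
  LieHom vir_to_w0_linear vir_to_w0_bracket.

End W0.

(* C[s,t], represented as (C[s])[t]: the outer variable is t. *)
Section PolyST.
Context (K : comNzRingType).

Definition polyst := {poly {poly K}}.
HB.instance Definition _ := GRing.ComNzRing.on polyst.

Definition cst (c : K) : polyst := c%:P%:P.
Definition var_s : polyst := 'X%:P.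
Definition var_t : polyst := 'X.
Definition in_t (p : {poly K}) : polyst := p ^:P.

(* f(s - m, t) *)
Definition shift_s (m : int) (f : polyst) : polyst :=
  map_poly (comp_poly ('X - m%:~R%:P)) f.

Definition deriv_t (f : polyst) : polyst := f^`().

Definition polyst_scale (c : K) (f : polyst) : polyst := cst c * f.

Fact polyst_scaleA a b f : polyst_scale a (polyst_scale b f) = polyst_scale (a * b) f.
Proof. by rewrite /polyst_scale mulrA /cst !polyCM. Qed.

Fact polyst_scale1 : left_id 1 polyst_scale.
Proof. by move=> f; rewrite /polyst_scale /cst mul1r. Qed.

Fact polyst_scaleDr : right_distributive polyst_scale +%R.
Proof. by move=> a f g; rewrite /polyst_scale mulrDr. Qed.

Fact polyst_scaleDl f : {morph polyst_scale^~ f : a b / a + b}.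
Proof. by move=> a b; rewrite /polyst_scale /cst !polyCD mulrDl. Qed.

HB.instance Definition _ := GRing.Zmodule_isLmodule.Build K polyst
  polyst_scaleA polyst_scale1 polyst_scaleDr polyst_scaleDl.

Lemma polyst_scaleE (c : K) (f : polyst) : c *: f = cst c * f.
Proof. by []. Qed.

Lemma cst0 : cst 0 = 0. Proof. by []. Qed.
Lemma cst1 : cst 1 = 1. Proof. by []. Qed.
Lemma cstN a : cst (- a) = - cst a. Proof. by rewrite /cst !polyCN. Qed.
Lemma cstD a b : cst (a + b) = cst a + cst b.
Proof. by rewrite /cst !polyCD. Qed.
Lemma cstB a b : cst (a - b) = cst a - cst b.
Proof. by rewrite cstD cstN. Qed.
Lemma cstM a b : cst (a * b) = cst a * cst b.
Proof. by rewrite /cst !polyCM. Qed.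

Lemma in_tD p q : in_t (p + q) = in_t p + in_t q. Proof. exact: rmorphD. Qed.
Lemma in_tB p q : in_t (p - q) = in_t p - in_t q. Proof. exact: rmorphB. Qed.
Lemma in_tM p q : in_t (p * q) = in_t p * in_t q. Proof. exact: rmorphM. Qed.
Lemma in_tC c : in_t c%:P = cst c. Proof. exact: map_polyC. Qed.
Lemma in_tX : in_t 'X = var_t. Proof. exact: map_polyX. Qed.
Lemma in_tZ c p : in_t (c *: p) = cst c * in_t p.
Proof. by rewrite -mul_polyC in_tM in_tC. Qed.

Lemma shift_sD m f g : shift_s m (f + g) = shift_s m f + shift_s m g.
Proof. exact: rmorphD. Qed.
Lemma shift_sN m f : shift_s m (- f) = - shift_s m f.
Proof. exact: rmorphN. Qed.
Lemma shift_sM m f g : shift_s m (f * g) = shift_s m f * shift_s m g.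
Proof. exact: rmorphM. Qed.
Lemma shift_s_cst m c : shift_s m (cst c) = cst c.
Proof. by rewrite /shift_s map_polyC /= comp_polyC. Qed.
Lemma shift_s_s m : shift_s m var_s = var_s - cst m%:~R.
Proof. by rewrite /shift_s map_polyC /= comp_polyX polyCB. Qed.
Lemma shift_s_t m : shift_s m var_t = var_t.
Proof. exact: map_polyX. Qed.
Lemma shift_s_in_t m p : shift_s m (in_t p) = in_t p.
Proof.
rewrite /shift_s /in_t -map_poly_comp_id0 ?comp_poly0 //.
by apply: eq_map_poly => c /=; rewrite comp_polyC.
Qed.
Lemma shift_s_shift m n f : shift_s m (shift_s n f) = shift_s (m + n) f.
Proof.
rewrite /shift_s -map_poly_comp_id0 ?comp_poly0 //.
apply: eq_map_poly => p /=; rewrite -comp_polyA comp_polyB comp_polyX comp_polyC.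
by rewrite intrD polyCD opprD addrA.
Qed.
Lemma shift_s_deriv m f : shift_s m (deriv_t f) = deriv_t (shift_s m f).
Proof. exact: esym (deriv_map _ _). Qed.

Lemma deriv_tD f g : deriv_t (f + g) = deriv_t f + deriv_t g.
Proof. exact: derivD. Qed.
Lemma deriv_tN f : deriv_t (- f) = - deriv_t f.
Proof. exact: derivN. Qed.
Lemma deriv_tM f g : deriv_t (f * g) = deriv_t f * g + f * deriv_t g.
Proof. exact: derivM. Qed.
Lemma deriv_t_cst c : deriv_t (cst c) = 0. Proof. exact: derivC. Qed.
Lemma deriv_t_s : deriv_t var_s = 0. Proof. exact: derivC. Qed.
Lemma deriv_t_t : deriv_t var_t = 1. Proof. exact: derivX. Qed.

Definition shift_sE := (shift_sD, shift_sN, shift_sM, shift_s_cst, shift_s_s,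
  shift_s_t, shift_s_in_t, shift_s_deriv, shift_s_shift).
Definition deriv_tE := (deriv_tD, deriv_tN, deriv_tM, deriv_t_cst, deriv_t_s, deriv_t_t).
Definition cstE := (cst0, cst1, cstN, cstD, cstM).

End PolyST.

Section WModules.
Context (K : numFieldType).

Section Phi.
Context (b lam alpha : K) (lam0 : lam != 0) (h : {poly K}).

(* The division is exact, see phi_gK. *)
Definition phi_g : {poly K} := (h - h.[alpha]%:P) %/ ('X - alpha%:P).

Definition phi_h (m : int) : {poly K} :=
  m%:~R *: h
  - (m%:~R * alpha * ((b == -1)%:R * (m%:~R - 1) + (b == 1)%:R)) *: phi_g.

Definition phi_L (m : int) (f : polyst K) : polyst K :=
  cst (lam ^ m) *
    ((var_s K + in_t (phi_h m)) * shift_s m f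
     + cst (b * m%:~R)
       * (var_t K - cst ((b == -1)%:R * m%:~R * alpha) - cst ((b == 1)%:R * alpha))
       * deriv_t (shift_s m f)).

Definition phi_W (m : int) (f : polyst K) : polyst K :=
  cst (lam ^ m) *
    ((var_t K - cst ((b == -1)%:R * m%:~R * alpha)
      - cst ((b == 1)%:R * (1 - (m == 0)%:R) * alpha)) * shift_s m f).

Definition phi_op (i : int + int) : polyst K -> polyst K :=
  match i with inl m => phi_L m | inr m => phi_W m end.

Fact phi_op_linear i : linear (phi_op i).
Proof.
case: i => m a f g; rewrite /= !polyst_scaleE /phi_L /phi_W !shift_sE ?deriv_tE;
  by ring.
Qed.

Lemma phi_gK : in_t h = cst h.[alpha] + (var_t K - cst alpha) * in_t phi_g.
Proof.
have : ('X - alpha%:P) %| h - h.[alpha]%:P.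
  by rewrite dvdp_XsubCl rootE !hornerE subrr.
move/divpK => eqg; rewrite -in_tX -!in_tC -in_tB -in_tM mulrC -/phi_g eqg -in_tD.
by rewrite addrC subrK.
Qed.

Fact phi_op_bracket i j f : basis_act phi_op (w0_br b i j) f
  = phi_op i (phi_op j f) - phi_op j (phi_op i f).
Proof.
have n1 : (1 == -1 :> K) = false.
  by rewrite -subr_eq0 opprK -[1 + 1]/(2%:R) pnatr_eq0.
have n1' : (-1 == 1 :> K) = false by rewrite eq_sym n1.
have DH : deriv_t (in_t h)
    = in_t phi_g + (var_t K - cst alpha) * deriv_t (in_t phi_g).
  by rewrite phi_gK !deriv_tE; ring.
have LW m n (n0 := ((n == 0)%:R : K)) (mn0 := ((m + n == 0)%:R : K)) :
    cst (n%:~R + b * m%:~R) * phi_W (m + n) f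
    = phi_L m (phi_W n f) - phi_W n (phi_L m f).
  rewrite /phi_L /phi_W /phi_h !(shift_sE, deriv_tE, in_tB, in_tZ).
  rewrite !expfzDr // (addrC n m) -/n0 -/mn0 !(intrD, intrB, cstE, cstB).
  have wn0 : cst n%:~R * cst n0 = 0.
    by rewrite -cstM /n0; have [->|_] := eqVneq n 0; rewrite ?mul0r ?mulr0 cst0.
  have wmn0 : (cst n%:~R + cst m%:~R) * cst mn0 = 0.
    rewrite -cstD -cstM -intrD /mn0 (addrC n m).
    by have [->|_] := eqVneq (m + n) 0; rewrite ?mul0r ?mulr0 cst0.
  move: wn0 wmn0; move: (in_t phi_g) (shift_s (m + n) f) (in_t h) => G F H.
  move: (deriv_t F) (cst (lam ^ m)) (cst (lam ^ n)) => F1 P Q.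
  move: (cst m%:~R) (cst n%:~R) (cst n0) (cst mn0) => M N z w.
  move: (cst alpha) (var_s K) (var_t K) => a s t wn0 wmn0.
  have [->|bN1] := eqVneq b (-1); last have [->|b1] := eqVneq b 1.
  - by rewrite n1' !cstE; ring.
  - rewrite !cstE; apply/eqP; rewrite -subr_eq0; apply/eqP.
    transitivity (P * Q * F * a * ((N + M) * w) - P * Q * F * a * (N * z)); first by ring.
    by rewrite wn0 wmn0 !mulr0 subrr.
  - by rewrite !cstE; ring.
have lin := basis_act_linear_l phi_op f.
have act0 : basis_act phi_op 0 f = 0.
  by rewrite /basis_act /linext msupp0 big_seq_fset0.
have actZ a k : basis_act phi_op (a *: << k >>) f = a *: phi_op k f.
  by rewrite -[a *: << k >>]addr0 lin basis_actU act0 addr0.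
case: i j => [m|m] [n|n]; rewrite ?actZ ?act0 /phi_op.
- rewrite polyst_scaleE /phi_L /phi_h.
  rewrite !(shift_sE, in_tB, in_tZ) !(deriv_tE, in_tB, in_tZ) DH phi_gK.
  rewrite [n + m]addrC !expfzDr // !(intrD, intrB, mulrNz, cstE, cstB).
  move: (in_t phi_g) (deriv_t (in_t phi_g)) (shift_s (m + n) f) => G G1 F.
  move: (deriv_t F) (deriv_t (deriv_t F)) => F1 F2.
  move: (cst (lam ^ m)) (cst (lam ^ n)) (cst m%:~R) (cst n%:~R) => P Q M N.
  move: (cst h.[alpha]) (cst alpha) (var_s K) (var_t K) => c a s t.
  have [->|bN1] := eqVneq b (-1); last have [->|b1] := eqVneq b 1.
  + by rewrite n1' !cstE; ring.
  + by rewrite !cstE; ring.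
  + by rewrite !cstE; ring.
- by rewrite polyst_scaleE LW.
- by rewrite scaleNr polyst_scaleE (addrC m n) LW opprB.
- by rewrite /phi_W !shift_sE (addrC n m); ring.
Qed.

Definition Phi : lieModule (w0 b) :=
  @LieModule K (w0 b) (polyst K) (basis_act phi_op) (basis_act_linear_l phi_op)
    (basis_act_linear_r phi_op_linear)
    (basis_act_bracket phi_op_linear phi_op_bracket).

End Phi.

Section Theta.
Context (lam : K) (lam0 : lam != 0) (h : {poly K}).

Definition theta_L (m : int) (f : polyst K) : polyst K :=
  cst (lam ^ m) * ((var_s K + cst m%:~R * in_t h) * shift_s m f).

Definition theta_W (m : int) (f : polyst K) : polyst K :=
  cst (m == 0)%:R * (var_t K * f).

Definition theta_op (i : int + int) : polyst K -> polyst K :=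
  match i with inl m => theta_L m | inr m => theta_W m end.

Fact theta_op_linear i : linear (theta_op i).
Proof.
by case: i => m a f g; rewrite /= !polyst_scaleE /theta_L /theta_W ?shift_sE; ring.
Qed.

Fact theta_op_bracket i j f : basis_act theta_op (w0_br 1 i j) f
  = theta_op i (theta_op j f) - theta_op j (theta_op i f).
Proof.
have LW m n :
    cst (n%:~R + 1 * m%:~R) * theta_W (m + n) f
    = theta_L m (theta_W n f) - theta_W n (theta_L m f).
  rewrite /theta_L /theta_W !shift_sE mul1r.
  set mn0 : K := (m + n == 0)%:R.
  rewrite mulrA -cstM.
  have -> : (n%:~R + m%:~R) * mn0 = 0.
    rewrite -intrD /mn0 (addrC n m).
    by have [->|_] := eqVneq (m + n) 0; rewrite ?mul0r ?mulr0.
  by rewrite cst0; ring.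
have lin := basis_act_linear_l theta_op f.
have act0 : basis_act theta_op 0 f = 0.
  by rewrite /basis_act /linext msupp0 big_seq_fset0.
have actZ a k : basis_act theta_op (a *: << k >>) f = a *: theta_op k f.
  by rewrite -[a *: << k >>]addr0 lin basis_actU act0 addr0.
case: i j => [m|m] [n|n]; rewrite ?actZ ?act0 /theta_op.
- rewrite polyst_scaleE /theta_L !shift_sE (addrC n m) !expfzDr //.
  by rewrite !(intrD, intrB, mulrNz, cstE, cstB); ring.
- by rewrite polyst_scaleE LW.
- by rewrite scaleNr polyst_scaleE (addrC m n) LW opprB.
- by rewrite /theta_W; ring.
Qed.

Definition Theta : lieModule (w0 (1 : K)) :=
  @LieModule K (w0 1) (polyst K) (basis_act theta_op) (basis_act_linear_l theta_op)
    (basis_act_linear_r theta_op_linear)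
    (basis_act_bracket theta_op_linear theta_op_bracket).

End Theta.
End WModules.

(* Main.v *)
(* Order the monomials t^j s^i lexicographically, t-degree first.  The operator
   L_0 is multiplication by s and moves a leading exponent (j, i) to (j, i + 1).
   If deg h >= 1, then L_1 moves it to (j + deg h, i): its only part raising the
   t-degree is multiplication by h_1(t), of degree deg h.  By Dickson's lemma
   finitely many elements of a submodule have leading exponents that generate,
   under these two moves, all leading exponents, and division by them
   terminates.  If h is constant, then no L_m raises the t-degree, so the
   polynomials of bounded t-degree form an exhausting chain of proper submodules
   and X itself is not finitely generated. *)
Require Import Defs.
From HB Require Import structures.
From mathcomp Require Import all_boot all_order all_algebra.
From mathcomp Require Import finmap boolp reals.
From mathcomp.real_closed Require Import complex.
From mathcomp.multinomials Require Import monalg.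
Import Order.TTheory GRing.Theory Num.Theory.
Local Open Scope ring_scope.
Local Open Scope complex_scope.

(** * Dickson's lemma for pairs of natural numbers *)

Lemma uniform_bound (n : nat) (Q : nat -> nat -> Prop) :
  (forall q b c, (b <= c)%N -> Q q b -> Q q c) -> (forall q, exists b, Q q b) ->
  exists B, forall q, (q < n)%N -> Q q B.
Proof.
move=> Qmono Qex; elim: n => [|n [B QB]]; first by exists 0%N.
have [b Qb] := Qex n; exists (maxn b B) => q; rewrite ltnS leq_eqVlt.
case/orP => [/eqP->|/QB]; first exact: Qmono (leq_maxl _ _) Qb.
exact: Qmono (leq_maxr _ _).
Qed.

(** A fixed pair (q0, i0) of [P] lies below every pair with q0 <= q and i0 <= i. Every other pair
    lies in one of the finitely many lines with q < q0 or i < i0, and each line has its own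
    bound. *)
Lemma dickson (P : nat -> nat -> Prop) :
  exists B, forall q i, P q i -> exists q' i',
    [/\ P q' i', (q' <= B)%N, (i' <= B)%N, (q' <= q)%N & (i' <= i)%N].
Proof.
have [[q0 [i0 P0]]|noP] := pselect (exists q i, P q i); last first.
  by exists 0%N => q i Pqi; case: noP; exists q, i.
have bound (R : nat -> nat -> Prop) (n : nat) :
    exists B, forall q, (q < n)%N -> forall i, R q i ->
      exists i', [/\ R q i', (i' <= B)%N & (i' <= i)%N].
  apply: (@uniform_bound n (fun q B => forall i, R q i ->
    exists i', [/\ R q i', (i' <= B)%N & (i' <= i)%N])).
    move=> q b c lebc Rb i /Rb[i' [Ri' lei'b lei'i]].
    by exists i'; split=> //; apply: leq_trans lebc.
  move=> q; have [[b Rb]|noR] := pselect (exists b, R q b); last first.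
    by exists 0%N => i Ri; case: noR; exists i.
  (* Any member [b] of the line serves as its bound: a member up to [b] is its own witness, a larger
     one has [b] below it. *)
  exists b => i Ri; case: (leqP i b) => [leib|/ltnW lebi].
    by exists i.
  by exists b.
have [B1 PB1] := bound P q0.
have [B2 PB2] := bound (fun i q => P q i) i0.
exists (maxn (maxn q0 i0) (maxn B1 B2)) => q i Pqi.
case: (ltnP q q0) => [ltq|leq0].
  have [i' [Pi' leB lei']] := PB1 q ltq i Pqi.
  by exists q, i'; split=> //; rewrite !leq_max ?(ltnW ltq) ?leB ?orbT.
case: (ltnP i i0) => [lti|lei0].
  have [q' [Pq' leB leq']] := PB2 i lti q Pqi.
  by exists q', i; split=> //; rewrite !leq_max ?(ltnW lti) ?leB ?orbT.
by exists q0, i0; split=> //; rewrite !leq_max leqnn ?orbT.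
Qed.

(** Moves of length [e] preserve the residue of j modulo [e], so Dickson's lemma is applied to the
    quotients in each residue class and the finitely many bounds are merged. *)
Lemma dickson_step (e : nat) (P : nat -> nat -> Prop) :
  (0 < e)%N -> exists B, forall j i, P j i -> exists j' i' k l,
    [/\ P j' i', (j' < B)%N, (i' < B)%N, j = (j' + k * e)%N & i = (i' + l)%N].
Proof.
move=> e0.
have [B PB] : exists B, forall r, (r < e)%N ->
    forall q i, P (r + q * e)%N i -> exists q' i',
    [/\ P (r + q' * e)%N i', (q' <= B)%N, (i' <= B)%N, (q' <= q)%N & (i' <= i)%N].
  apply: (@uniform_bound e (fun r B => forall q i, P (r + q * e)%N i ->
    exists q' i', [/\ P (r + q' * e)%N i', (q' <= B)%N, (i' <= B)%N,
      (q' <= q)%N & (i' <= i)%N])).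
    move=> r b c lebc Pb q i /Pb[q' [i' [P' leq' lei' qq ii]]].
    by exists q', i'; split; rewrite ?(leq_trans _ lebc).
  by move=> r; apply: (dickson (fun q i => P (r + q * e)%N i)).
(* This number strictly exceeds both i' <= B and r + q' * e for r < e and q' <= B. *)
exists (B.+1 * e.+1)%N => j i.
rewrite {1}(divn_eq j e) addnC => /(PB _ (ltn_pmod j e0)).
case=> q' [i' [P' leq' lei' qq ii]].
exists (j %% e + q' * e)%N, i', (j %/ e - q')%N, (i - i')%N; split=> //.
- rewrite mulSn -addSn leq_add ?leq_mul ?leqnSn //.
  by rewrite leqW // ltn_pmod.
- by rewrite mulnS (leq_trans _ (leq_addr _ _)).
- by rewrite -addnA -mulnDl subnKC // addnC -divn_eq.
- by rewrite subnKC.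
Qed.

(** * Leading exponents and division in (K[s])[t] *)

Section LeadingExponents.
Set Implicit Arguments.
Unset Strict Implicit.
Context (K : fieldType) (e : nat) (A : {poly {poly K}} -> {poly {poly K}}).

(** Here ['X%:P] is s, by which L_0 acts, and [A] stands for L_1; every submodule is closed under
    these operations. *)
Definition poly2_stable (N : {poly {poly K}} -> Prop) : Prop :=
  [/\ forall f g, N f -> N g -> N (f + g), forall c f, N f -> N (c%:P%:P * f),
      forall f, N f -> N ('X%:P * f) & forall f, N f -> N (A f)].

Definition lead_exponent (f : {poly {poly K}}) (j i : nat) : Prop :=
  size f = j.+1 /\ size (lead_coef f) = i.+1.

Context (e0 : (0 < e)%N).
Context (size_A : forall f : {poly {poly K}}, f != 0 -> size (A f) = (size f + e)%N).
Context (size_lead_A : forall f : {poly {poly K}}, f != 0 ->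
  size (lead_coef (A f)) = size (lead_coef f)).

Lemma exponent_neq0 f j i : lead_exponent f j i -> f != 0.
Proof. by case=> szf _; rewrite -size_poly_eq0 szf. Qed.

Lemma exponent_mulX f j i : lead_exponent f j i -> lead_exponent ('X%:P * f) j i.+1.
Proof.
move=> ef; have f0 := exponent_neq0 ef; case: ef => szf szl; split.
  by rewrite size_Cmul ?polyX_eq0.
by rewrite lead_coefM lead_coefC mulrC size_mulX ?lead_coef_eq0 // szl.
Qed.

Lemma exponent_step f j i : lead_exponent f j i -> lead_exponent (A f) (j + e) i.
Proof.
move=> ef; have f0 := exponent_neq0 ef; case: ef => szf szl; split.
  by rewrite size_A // szf addSn.
by rewrite size_lead_A.
Qed.

Lemma exponent_iter (N : {poly {poly K}} -> Prop) f j i k l :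
  poly2_stable N -> N f -> lead_exponent f j i ->
  exists g, [/\ N g & lead_exponent g (j + k * e) (i + l)].
Proof.
move=> [_ _ NX NA] Nf ef.
elim: k => [|k [g [Ng eg]]]; last first.
  by exists (A g); split; [exact: NA|rewrite mulSnr addnA; exact: exponent_step].
elim: l => [|l [g [Ng eg]]]; first by exists f; rewrite mul0n !addn0.
by exists ('X%:P * g); split; [exact: NX|rewrite addnS; exact: exponent_mulX].
Qed.

(** [S] contains an element for each leading exponent of [N] inside the box given by [dickson_step].
    The leading term of any other element of [N] is cancelled by an iterate of some member of [S].
    Letting [N'] range over the submodules containing [S] yields finite generation. *)
Lemma poly2_stable_finite_basis (N : {poly {poly K}} -> Prop) : N 0 -> poly2_stable N ->
  exists S : seq {poly {poly K}}, (forall u, u \in S -> N u) /\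
    forall N', N' 0 -> poly2_stable N' -> (forall u, u \in S -> N' u) ->
      forall v, N v -> N' v.
Proof.
move=> N0 stN; pose P j i := exists2 f, N f & lead_exponent f j i.
have [B PB] := dickson_step e P e0.
have [S [SN SP]] : exists S : seq {poly {poly K}}, (forall u, u \in S -> N u) /\
    forall j i, (j < B)%N -> (i < B)%N -> P j i ->
      exists2 u, u \in S & lead_exponent u j i.
  (* The box is listed as a sequence of pairs, so that witnesses are collected by induction along
     it. *)
  have [S [SN SP]] : exists S : seq {poly {poly K}}, (forall u, u \in S -> N u) /\
      forall x, x \in [seq (j, i) | j <- iota 0 B, i <- iota 0 B] ->
      P x.1 x.2 -> exists2 u, u \in S & lead_exponent u x.1 x.2.
    elim: [seq _ | _ <- _, _ <- _] => [|x xs [S [SN SP]]]; first by exists [::].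
    have [[f Nf ef]|noP] := pselect (P x.1 x.2); last first.
      by exists S; split=> // y /predU1P[-> /noP|/SP].
    exists (f :: S); split=> [u /predU1P[->|/SN]//|y].
    case/predU1P => [-> _|/SP yP /yP[u uS eu]]; first by exists f; rewrite ?mem_head.
    by exists u; rewrite // inE uS orbT.
  exists S; split=> // j i ltj lti; apply: (SP (j, i)).
  by apply/allpairsP; exists (j, i); rewrite !mem_iota.
exists S; split=> // N' N'0 stN' SN' v.
(* Lexicographic induction: [n] bounds the size in t, and the inner [m] bounds the size in s of the
   coefficient of t^n. When [m] reaches 0 that coefficient vanishes and the outer hypothesis
   applies. *)
suff N'n (n : nat) : forall v : {poly {poly K}}, N v -> (size v <= n)%N -> N' v.
  by move=> Nv; apply: N'n Nv (leqnn _).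
elim: n => [|n IHn] {}v Nv szv.
  by move: szv; rewrite leqn0 size_poly_eq0 => /eqP->.
suff N'm (m : nat) : forall v : {poly {poly K}}, N v -> (size v <= n.+1)%N -> (size (v`_n)%R <= m)%N -> N' v.
  by apply: N'm Nv szv (leqnn _).
elim: m {v Nv szv} => [|m IHm] v Nv szv szvn.
  apply: IHn => //; apply/leq_sizeP => j; rewrite leq_eqVlt => /predU1P[<-|ltnj].
    by apply/eqP; rewrite -size_poly_leq0.
  by rewrite nth_default // (leq_trans szv).
have [vnm0|vnm0] := eqVneq v`_n`_m 0.
  apply: IHm => //; apply/leq_sizeP => j; rewrite leq_eqVlt => /predU1P[<-//|ltmj].
  by rewrite nth_default // (leq_trans szvn).
have szvnE : size v`_n = m.+1.
  by apply/eqP; rewrite eqn_leq szvn ltnNge; apply: contra vnm0 => /leq_sizeP->.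
have szvE : size v = n.+1.
  apply/eqP; rewrite eqn_leq szv ltnNge; apply: contra vnm0 => /leq_sizeP->//.
  by rewrite coef0.
have [j [i [k [l [Pji ltj lti nE mE]]]]] : exists j i k l,
    [/\ P j i, (j < B)%N, (i < B)%N, n = (j + k * e)%N & m = (i + l)%N].
  by apply: PB; exists v => //; split=> //; rewrite lead_coefE szvE.
have [u uS eu] := SP j i ltj lti Pji.
(* The iterate [w] of [u] is needed in [N'] to rebuild [v], and in [N] so that the remainder falls
   under the induction hypothesis. *)
pose NN' f := N f /\ N' f.
have stNN' : poly2_stable NN'.
  case: stN stN' => [ND NZ NX NA] [N'D N'Z N'X N'A]; split.
  - by move=> f g [? ?] [? ?]; split; [exact: ND|exact: N'D].
  - by move=> c f [? ?]; split; [exact: NZ|exact: N'Z].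
  - by move=> f [? ?]; split; [exact: NX|exact: N'X].
  - by move=> f [? ?]; split; [exact: NA|exact: N'A].
have [w [[Nw N'w]]] := exponent_iter k l stNN' (conj (SN u uS) (SN' u uS)) eu.
rewrite -nE -mE => -[szw]; rewrite lead_coefE szw /= => szwn.
have wnm0 : w`_n`_m != 0.
  by rewrite -[m]/(m.+1.-1) -szwn -lead_coefE lead_coef_eq0 -size_poly_eq0 szwn.
(* This scalar cancels the coefficient of t^n s^m. *)
pose c := v`_n`_m / w`_n`_m.
rewrite -(subrK (c%:P%:P * w) v).
case: stN stN' => [ND NZ NX NA] [N'D N'Z N'X N'A].
apply: N'D; last exact: N'Z.
apply: IHm.
- by rewrite -mulNr -!polyCN; apply: (ND) Nv _; apply: NZ Nw.
- rewrite (leq_trans (size_polyD _ _)) // geq_max szv size_polyN mul_polyC.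
  by rewrite (leq_trans (size_scale_leq _ _)) ?szw.
- apply/leq_sizeP => j'; rewrite coefB coefCM coefB coefCM.
  rewrite leq_eqVlt => /predU1P[<-|ltmj']; first by rewrite divfK ?subrr.
  have coef0m (p : {poly K}) : size p = m.+1 -> p`_j' = 0.
    by move=> szp; rewrite nth_default ?szp.
  by rewrite !coef0m // mulr0 subrr.
Qed.

End LeadingExponents.

(** * Effect of the operators L_m on sizes *)

Section Modules.
Set Implicit Arguments.
Unset Strict Implicit.
Context (K : numFieldType).

Lemma size_shift_s m (f : {poly {poly K}}) : size (shift_s m f : {poly {poly K}}) = size f.
Proof.
apply: size_map_inj_poly; last exact: comp_poly0.
by apply: raddf_inj => p /eqP; rewrite comp_poly_eq0 ?size_XsubC // => /eqP.
Qed.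

Lemma size_lead_shift_s m (f : {poly {poly K}}) :
  size (lead_coef (shift_s m f : {poly {poly K}})) = size (lead_coef f).
Proof.
rewrite lead_coef_map_inj ?comp_poly0 ?size_comp_poly2 ?size_XsubC //.
by apply: raddf_inj => p /eqP; rewrite comp_poly_eq0 ?size_XsubC // => /eqP.
Qed.

(* The common shape of the operators L_m of Phi and of Theta, for which w = 0. *)
Definition shift_op (a : K) (q : {poly K}) (w : polyst K) (m : int)
    (f : polyst K) : polyst K :=
  cst a * ((var_s K + in_t q) * shift_s m f + w * deriv_t (shift_s m f)).

Lemma size_shift_op_leq a (q : {poly K}) (w : {poly {poly K}}) m (f : {poly {poly K}}) :
  (size q <= 1)%N -> (size w <= 2)%N ->
  (size (shift_op a q w m f : {poly {poly K}}) <= size f)%N.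
Proof.
move=> /size1_polyC-> szw.
have sC (p : {poly K}) (g : {poly {poly K}}) : (size (p%:P * g)%R <= size g)%N.
  by rewrite mul_polyC size_scale_leq.
apply: leq_trans (sC _ _) _; rewrite (leq_trans (size_polyD _ _)) // geq_max.
rewrite in_tC /var_s /cst -polyCD (leq_trans (sC _ _)) ?size_shift_s //=.
have [->|f0] := eqVneq f 0.
  by rewrite /shift_s rmorph0 /deriv_t deriv0 mulr0 size_poly0.
rewrite (leq_trans (size_polyMleq _ _)) //.
have lt_d : (size (deriv_t (shift_s m f) : {poly {poly K}}) < size f)%N.
  by rewrite -(size_shift_s m f) lt_size_deriv // -size_poly_eq0 size_shift_s size_poly_eq0.
by rewrite -subn1 leq_subLR add1n (leq_trans (leq_add szw (leqnn _))) // addnC addn2 ltnS.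
Qed.

(** Multiplication by s + q(t) dominates: its leading coefficient in t is a nonzero constant, so the
    s-degree of the leading coefficient is kept. The other term has t-degree at most that of [f],
    since [w] regains at most the degree lost to the derivative. *)
Lemma lead_shift_op a (q : {poly K}) (w : {poly {poly K}}) m (f : {poly {poly K}}) :
  a != 0 -> (1 < size q)%N -> (size w <= 2)%N -> f != 0 ->
  size (shift_op a q w m f : {poly {poly K}}) = (size f + (size q).-1)%N /\
  size (lead_coef (shift_op a q w m f : {poly {poly K}})) = size (lead_coef f).
Proof.
move=> a0 szq szw f0.
have szqt : size (in_t q : {poly {poly K}}) = size q.
  by rewrite /in_t size_map_inj_poly //; apply: polyC_inj.
have lcqt : lead_coef (in_t q : {poly {poly K}}) = (lead_coef q)%:P.
  by rewrite /in_t lead_coef_map_inj //; apply: polyC_inj.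
pose u : {poly {poly K}} := var_s K + in_t q.
have lt_s : (size (var_s K : {poly {poly K}}) < size (in_t q : {poly {poly K}}))%N.
  by rewrite szqt (leq_ltn_trans (size_polyC_leq1 _)).
have szu : size u = size q by rewrite /u addrC size_polyDl // szqt.
have lcu : lead_coef u = (lead_coef q)%:P by rewrite /u addrC lead_coefDl // lcqt.
have q0 : q != 0 by rewrite -size_poly_gt0 (ltn_trans _ szq).
have u0 : u != 0 by rewrite -size_poly_gt0 szu (ltn_trans _ szq).
pose F : {poly {poly K}} := shift_s m f.
have szF : size F = size f by exact: size_shift_s.
have F0 : F != 0 by rewrite -size_poly_eq0 szF size_poly_eq0.
have szuF : size (u * F) = (size f + (size q).-1)%N.
  by rewrite size_mul // szu szF addnC -(ltn_predK szq) addnS.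
have lt_w : (size (w * deriv_t F)%R < size (u * F)%R)%N.
  rewrite szuF (leq_ltn_trans (size_polyMleq _ _)) //.
  have lt_d : (size (deriv_t F : {poly {poly K}}) < size f)%N.
    by rewrite -szF lt_size_deriv.
  rewrite (@leq_ltn_trans (size f)) //; last first.
    by rewrite -addn1 leq_add2l -subn1 subn_gt0.
  by rewrite -subn1 leq_subLR add1n (leq_trans (leq_add szw (leqnn _))) // addnC addn2 ltnS.
rewrite /shift_op -/F -/u; split.
  by rewrite size_Cmul ?polyC_eq0 // size_polyDl.
rewrite lead_coefM lead_coefC lead_coefDl // lead_coefM lcu size_Cmul //.
by rewrite size_Cmul ?lead_coef_eq0 // size_lead_shift_s.
Qed.

(** * Finite generation for modules whose L_m are shift operators *)

Section ShiftModule.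
Context (b lam : K) (lam0 : lam != 0).
Context (op : int + int -> polyst K -> polyst K).
Context (op_linear : forall x, linear (basis_act op x)).
Context (op_bracket : forall (x y : w0 b) v, basis_act op (bracket x y) v =
  basis_act op x (basis_act op y v) - basis_act op y (basis_act op x v)).
Context (q : int -> {poly K}) (w : int -> {poly {poly K}}).
Context (op_inl : forall m f, op (inl m) f = shift_op (lam ^ m) (q m) (w m) m f).
Context (size_w : forall m, (size (w m) <= 2)%N).

Definition shift_module : lieModule (vir K) :=
  restrict_module (vir_to_w0 b)
    (@LieModule K (w0 b) (polyst K) (basis_act op) (basis_act_linear_l op)
      op_linear op_bracket).

Lemma shift_module_actL m (f : shift_module) :
  lact (virL K m : vir K) f = op (inl m) f.
Proof.
rewrite /= /vir_to_w0_fun /virL.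
by rewrite [X in basis_act op X f]linextU /w0L basis_actU.
Qed.

(** A Virasoro element is a finite combination of the L_m and C, and C acts as 0. *)
Lemma shift_module_submodule (N : shift_module -> Prop) :
  N 0 -> (forall f g, N f -> N g -> N (f + g)) ->
  (forall (c : K) f, N f -> N (c *: f)) -> (forall m f, N f -> N (op (inl m) f)) ->
  lie_submodule N.
Proof.
move=> N0 ND NZ NL; split=> // x f Nf.
have act0 : basis_act op 0 f = 0.
  by rewrite /basis_act /linext msupp0 big_seq_fset0.
rewrite /= /vir_to_w0_fun {1}/linext.
elim: (enum_fset _) => [|i s IHs]; first by rewrite big_nil act0.
rewrite big_cons (basis_act_linear_l op); apply: (ND) IHs; apply: NZ.
by case: i => [m|]; rewrite ?act0 // /w0L basis_actU; apply: NL.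
Qed.

Lemma shift_module_noetherian : q 0 = 0 -> w 0 = 0 -> (1 < size (q 1))%N ->
  forall N : shift_module -> Prop, lie_submodule N -> finitely_generated N.
Proof.
move=> q0 w00 szq N [N0 ND NZ Nact].
(* With [q 0] and [w 0] zero and no shift of s, only multiplication by s remains of L_0. *)
have opL0 f : op (inl 0) f = var_s K * f.
  rewrite op_inl /shift_op q0 w00 expr0z cst1 in_tC cst0 mul1r mul0r !addr0.
  by congr (_ * _); apply: map_poly_id => p _; rewrite subr0 comp_polyXr.
have e0 : (0 < (size (q 1)).-1)%N by rewrite -subn1 subn_gt0.
have lead f (f0 : f != 0) :=
  lead_shift_op (w := w 1) 1 (expfz_neq0 1 lam0) szq (size_w 1) f0.
pose A (f : {poly {poly K}}) : {poly {poly K}} := op (inl 1) f.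
have size_A (f : {poly {poly K}}) : f != 0 -> size (A f) = (size f + (size (q 1)).-1)%N.
  by rewrite /A op_inl => /lead[].
have size_lead_A (f : {poly {poly K}}) : f != 0 ->
    size (lead_coef (A f)) = size (lead_coef f).
  by rewrite /A op_inl => /lead[].
have stable (N' : shift_module -> Prop) : lie_submodule N' -> poly2_stable A N'.
  move=> [N'0 N'D N'Z N'act]; split=> // f N'f.
  - by have := N'act (virL K 0) f N'f; rewrite shift_module_actL opL0.
  - by have := N'act (virL K 1) f N'f; rewrite shift_module_actL.
have subN : lie_submodule N by split.
have [S [SN SP]] := poly2_stable_finite_basis e0 size_A size_lead_A N0 (stable N subN).
exists S => v; split=> [Nv N' subN' SN'|]; last by apply.
by apply: (SP N') Nv => //; [case: subN'|exact: stable].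
Qed.

Lemma shift_module_not_finitely_generated : (forall m, size (q m) <= 1)%N ->
  ~ finitely_generated (fun _ : shift_module => True).
Proof.
move=> szq [S genS].
pose n := \max_(u <- S) size (u : {poly {poly K}}).
pose N (f : shift_module) : Prop := (size (f : {poly {poly K}}) <= n)%N.
have subN : lie_submodule N.
  apply: shift_module_submodule.
  - by rewrite /N size_poly0.
  - move=> f g Nf Ng; rewrite /N (leq_trans (size_polyD _ _)) // geq_max.
    by apply/andP.
  - move=> c f; apply: leq_trans.
    by rewrite polyst_scaleE /cst mul_polyC size_scale_leq.
  - by move=> m f; apply: leq_trans; rewrite op_inl size_shift_op_leq.
have SN u : u \in S -> N u.
  move=> uS.
  exact: (@leq_bigmax_seq _ S xpredT (fun u : {poly {poly K}} => size u) u uS isT).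
(* The power t^n has size n + 1, just beyond the bound on the generators. *)
have [/(_ I) /(_ N subN SN)] := genS ('X^n : {poly {poly K}}).
by rewrite /N size_polyXn ltnn.
Qed.

(** The condition [1 < size h] means that h has degree at least 1; the zero polynomial, of size 0,
    falls on the constant side. *)
Lemma shift_module_criterion (h : {poly K}) : q 0 = 0 -> w 0 = 0 ->
  ((1 < size h)%N -> size (q 1) = size h) ->
  ((size h <= 1)%N -> forall m, (size (q m) <= 1)%N) ->
  (forall N : shift_module -> Prop, lie_submodule N -> finitely_generated N)
    <-> (1 < size h)%N.
Proof.
move=> q0 w00 szq_gt1 szq_le1; split=> [fg|szh].
  rewrite ltnNge; apply/negP => /szq_le1 /shift_module_not_finitely_generated.
  by apply; apply: fg; apply: shift_module_submodule.
by apply: shift_module_noetherian => //; rewrite szq_gt1.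
Qed.

End ShiftModule.

(** * The modules Φ and Θ *)

(** The correction to h in h_1 is a scalar multiple of g, whose degree is below that of h. *)
Lemma size_phi_h1 (b alpha : K) (h : {poly K}) :
  (1 < size h)%N -> size (phi_h b alpha h 1) = size h.
Proof.
move=> szh; rewrite /phi_h scale1r size_polyDl // size_polyN.
apply: leq_ltn_trans (size_scale_leq _ _) _.
rewrite size_divp ?polyXsubC_eq0 // size_XsubC.
rewrite (@leq_ltn_trans (size h).-1) ?ltn_predL ?(ltn_trans _ szh) //.
rewrite subn1 -!subn1 leq_sub2r // (leq_trans (size_polyD _ _)) // size_polyN.
by rewrite geq_max leqnn (leq_trans (size_polyC_leq1 _)) // ltnW.
Qed.

(** For constant h the quotient g vanishes, which leaves only m h. *)
Lemma size_phi_h_const (b alpha : K) (h : {poly K}) m :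
  (size h <= 1)%N -> (size (phi_h b alpha h m) <= 1)%N.
Proof.
move=> /size1_polyC->; rewrite /phi_h /phi_g hornerC subrr div0p scaler0 subr0.
by rewrite (leq_trans (size_scale_leq _ _)) ?size_polyC_leq1.
Qed.

Lemma Phi_criterion (b alpha lam : K) (lam0 : lam != 0) (h : {poly K}) :
  (forall N : restrict_module (vir_to_w0 b) (Phi b alpha lam0 h) -> Prop,
    lie_submodule N -> finitely_generated N) <-> (1 < size h)%N.
Proof.
pose w m : {poly {poly K}} := cst (b * m%:~R) *
  (var_t K - cst ((b == -1)%:R * m%:~R * alpha) - cst ((b == 1)%:R * alpha)).
apply: (@shift_module_criterion b lam lam0 (phi_op b lam alpha h) _ _
  (phi_h b alpha h) w).
- by move=> m f; rewrite /= /phi_L /shift_op.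
- move=> m; rewrite /w /cst mul_polyC (leq_trans (size_scale_leq _ _)) //.
  by rewrite -addrA -opprD -polyCD size_XsubC.
- by rewrite /phi_h mul0r mul0r !scale0r subr0.
- by rewrite /w mulr0 cst0 mul0r.
- exact: size_phi_h1.
- by move=> szh m; apply: size_phi_h_const.
Qed.

Lemma Theta_criterion (lam : K) (lam0 : lam != 0) (h : {poly K}) :
  (forall N : restrict_module (vir_to_w0 1) (Theta lam0 h) -> Prop,
    lie_submodule N -> finitely_generated N) <-> (1 < size h)%N.
Proof.
apply: (@shift_module_criterion 1 lam lam0 (theta_op lam h) _ _
  (fun m => m%:~R *: h) (fun=> 0)).
- by move=> m f; rewrite /= /theta_L /shift_op mul0r addr0 in_tZ.
- by move=> m; rewrite size_poly0.
- by rewrite scale0r.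
- by [].
- by rewrite scale1r.
- by move=> szh m; rewrite (leq_trans (size_scale_leq _ _)).
Qed.

End Modules.

Theorem theorem3p5 (R : realType) (b alpha lam : R[i]) (lam0 : lam != 0)
    (h : {poly R[i]}) (X : lieModule (vir R[i])) :
  X = restrict_module (vir_to_w0 b) (Phi b alpha lam0 h)
  \/ X = restrict_module (vir_to_w0 1) (Theta lam0 h) ->
  ((forall N : X -> Prop, lie_submodule N -> finitely_generated N)
    <-> (1 < size h)%N).
Proof. by case=> ->; [exact: Phi_criterion|exact: Theta_criterion]. Qed.
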